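(* The maj-Wilf equivalence class of $\{132,213\}$ is $$\big\{\{132,213\},\{132,312\},\{213,231\},\{231,312\}\big\}.$$ All other maj-Wilf equivalence classes for $\Pi\subset\mathfrak S_3$ with $\#\Pi=2$ and $\Pi\neq\{123,321\}$ contain a single pair.
   Context: $\mathfrak S_n$ is the set of permutations $\sigma=a_1a_2\ldots a_n$ of $[n]$ in one-line notation. A permutation $\sigma$ avoids $\pi\in\mathfrak S_k$ if no subsequence of $\sigma$ is order isomorphic to $\pi$ (has its entries in the same relative order as $\pi$). For a set $\Pi$ of permutations, $\mathrm{Av}_n(\Pi)$ is the set of $\sigma\in\mathfrak S_n$ avoiding every element of $\Pi$. The major index is $\mathrm{maj}\,\sigma=\sum_{i:\,a_i>a_{i+1}} i$, and $M_n(\Pi;q)=\sum_{\sigma\in \mathrm{Av}_n(\Pi)}q^{\mathrm{maj}\,\sigma}$. Sets $\Pi,\Pi'$ are maj-Wilf equivalent if $M_n(\Pi;q)=M_n(\Pi';q)$ for all $n\ge0$. Equivalence classes are taken among subsets of $\mathfrak S_3$. *)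

(* Defs.v *)
From mathcomp Require Import all_boot all_algebra all_fingroup.

Set Implicit Arguments.
Unset Strict Implicit.
Unset Printing Implicit Defensive.

Import GRing.Theory.

(* A permutation a_1 a_2 ... a_n of [n] is an element s of 'S_n, with 0-based
   positions and values: a_(i+1) = s i + 1. *)

(* The permutation with one-line notation t (entries shifted to 0-based). *)
Definition oneline n (t : n.-tuple 'I_n) (t_uniq : uniq t) : 'S_n :=
  perm (elimT (tuple_uniqP t) t_uniq).

Lemma onelineE n (t : n.-tuple 'I_n) (t_uniq : uniq t) (i : 'I_n) :
  oneline t_uniq i = tnth t i.
Proof. exact: permE. Qed.

Definition e1 : 'I_3 := @Ordinal 3 0 isT.
Definition e2 : 'I_3 := @Ordinal 3 1 isT.
Definition e3 : 'I_3 := @Ordinal 3 2 isT.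

Definition p123 : 'S_3 := @oneline 3 [tuple e1; e2; e3] isT.
Definition p132 : 'S_3 := @oneline 3 [tuple e1; e3; e2] isT.
Definition p213 : 'S_3 := @oneline 3 [tuple e2; e1; e3] isT.
Definition p231 : 'S_3 := @oneline 3 [tuple e2; e3; e1] isT.
Definition p312 : 'S_3 := @oneline 3 [tuple e3; e1; e2] isT.
Definition p321 : 'S_3 := @oneline 3 [tuple e3; e2; e1] isT.

Definition contains k n (p : 'S_k) (s : 'S_n) : bool :=
  [exists f : {ffun 'I_k -> 'I_n},
     [forall i : 'I_k, forall j : 'I_k, (i < j) ==> (f i < f j)] &&
     [forall i : 'I_k, forall j : 'I_k,
        (s (f i) < s (f j)) == (p i < p j)]].

Definition avoids k n (p : 'S_k) (s : 'S_n) : bool := ~~ contains p s.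

Definition Av k n (Pi : {set 'S_k}) : {set 'S_n} :=
  [set s : 'S_n | [forall p in Pi, avoids p s]].

(* A descent at the adjacent 0-based positions i, j = i + 1 is a descent at the
   1-based position i + 1. *)
Definition maj n (s : 'S_n) : nat :=
  \sum_(i < n) \sum_(j < n | (j == i.+1 :> nat) && (s j < s i)) i.+1.

Definition M k n (Pi : {set 'S_k}) : {poly int} :=
  (\sum_(s in Av n Pi) 'X^(maj s))%R.

Definition maj_Wilf k (Pi Pi' : {set 'S_k}) : Prop :=
  forall n : nat, M n Pi = M n Pi'.

(* The equivalence class of Pi, as a predicate on the subsets of 'S_k. *)
Definition maj_Wilf_class k (Pi : {set 'S_k}) : {set 'S_k} -> Prop :=
  fun Pi' => maj_Wilf Pi Pi'.

(* Main.v *)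
Require Import Defs.
From mathcomp Require Import all_boot all_algebra all_fingroup.
From mathcomp Require Import zify.

Set Implicit Arguments.
Unset Strict Implicit.
Unset Printing Implicit Defensive.

Import GRing.Theory.

(** For positions i < j < k of a permutation s, write a = [s i < s j],
b = [s j < s k] and c = [s i < s k].  The six patterns of length three are the
six triples (a, b, c) compatible with transitivity: c is free when a <> b, and
c = a when a = b.  Hence avoiding one of 132, 231 (where a = 1, b = 0) and one
of 213, 312 (where a = 0, b = 1) amounts to c = op a b for an idempotent boolean
operation op, and the four choices are

    {132, 213} : and,             {132, 312} : right projection,
    {213, 231} : left projection, {231, 312} : or.

All four operations are associative, so in an avoiding permutation [s i < s j]
is the op-product of the ascent bits between i and j, and s is determined by its
descent set (descent_set_inj).  Conversely the op-products of an arbitrary bit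
sequence define a linear order on the positions, hence a permutation with any
prescribed descent set (descent_set_surj).  As maj is the sum of the descent
set, in all four cases M_n is the sum of q^(sum of A) over all subsets A of
[n-1] (M_descent_sets), so the four pairs are maj-Wilf equivalent.

That there are no further coincidences involving a pair is a finite check: the
coefficients of M_3 and M_4 already separate every pair from every other subset
of S_3, of any size, except within the four pairs above
(signature_separates). *)

(** * Permutations as linear orders on positions *)

(** Ranks make a permutation recoverable from its order relation. *)
Lemma perm_rank n (s : 'S_n) (i : 'I_n) : s i = #|[set j | s j < s i]| :> nat.
Proof.
transitivity #|[set y : 'I_n | y < s i]|; last first.
  rewrite -(card_imset _ (@perm_inj _ s)); apply: eq_card => y.
  apply/idP/imsetP => [|[j + ->]]; rewrite !inE // => lt_y.
  by exists ((s^-1)%g y); rewrite ?inE permKV.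
have le_sin : s i <= n by apply: ltnW.
have widen_inj : injective (widen_ord le_sin).
  by move=> x y /(congr1 val) /= /val_inj.
rewrite -[LHS](card_ord (s i)) -(card_imset _ widen_inj).
apply: eq_card => y; rewrite !inE; apply/imsetP/idP => [[x _ ->] | ltyi] /=.
  exact: ltn_ord.
by exists (Ordinal ltyi) => //; apply: val_inj.
Qed.

Lemma perm_order_inj n (s t : 'S_n) :
  (forall i j, (s i < s j) = (t i < t j)) -> s = t.
Proof.
move=> eq_st; apply/permP=> i; apply: val_inj.
rewrite /= (perm_rank s) (perm_rank t); congr #|pred_of_set _|.
by apply/setP=> j; rewrite !inE eq_st.
Qed.

(** The permutation sends each position to the number of positions below it. *)
Lemma perm_of_order n (R : rel 'I_n) :
    irreflexive R -> transitive R -> (forall i j, i != j -> R i j || R j i) ->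
  exists s : 'S_n, forall i j, (s i < s j) = R i j.
Proof.
move=> Rirr Rtr Rtot.
pose down i := [set j | R j i].
have rank_lt i : #|down i| < n.
  rewrite -[X in _ < X]card_ord -cardsT; apply: proper_card; apply/properP.
  by split; [apply: subsetT | exists i; rewrite !inE ?Rirr].
have rank_mono i j : R i j -> #|down i| < #|down j|.
  move=> Rij; apply: proper_card; apply/properP; split.
    by apply/subsetP=> x; rewrite !inE => /Rtr; apply.
  by exists i; rewrite !inE ?Rirr.
have rank_inj : injective (fun i => Ordinal (rank_lt i)).
  move=> i j [eq_rank]; apply/eqP; apply: contraT => /Rtot.
  by case/orP=> /rank_mono; rewrite eq_rank ltnn.
exists (perm rank_inj) => i j; rewrite !permE /=.
have [->|/Rtot] := eqVneq i j; first by rewrite ltnn Rirr.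
have [Rij _|nRij /= Rji] := boolP (R i j); first exact: rank_mono.
by apply/negbTE; rewrite -leqNgt ltnW ?rank_mono.
Qed.

(** * Words and the major index *)

Definition word n (s : 'S_n) : seq nat := [seq val (s i) | i <- enum 'I_n].

Lemma size_word n (s : 'S_n) : size (word s) = n.
Proof. by rewrite size_map size_enum_ord. Qed.

Lemma nth_word n (s : 'S_n) (i : 'I_n) : nth 0 (word s) i = s i.
Proof. by rewrite (nth_map i) ?size_enum_ord // nth_ord_enum. Qed.

Lemma word_inj n : injective (@word n).
Proof.
move=> s t eq_w; apply/permP=> i; apply: val_inj.
by rewrite /= -!nth_word eq_w.
Qed.

Lemma perm_eq_words n :
  perm_eq [seq word s | s : 'S_n] (permutations (iota 0 n)).
Proof.
have uniq_words : uniq [seq word s | s : 'S_n].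
  by rewrite map_inj_uniq ?enum_uniq //; apply: word_inj.
apply: uniq_perm; rewrite ?permutations_uniq //.
apply: (snd (uniq_min_size uniq_words _ _)) => [w /mapP[s _ ->]|].
  rewrite mem_permutations /word -val_enum_ord (map_comp val s).
  apply: perm_map; apply: uniq_perm; rewrite ?enum_uniq //.
    by rewrite map_inj_uniq ?enum_uniq //; apply: perm_inj.
  move=> i; rewrite mem_enum; apply/mapP; exists ((s^-1)%g i).
    by rewrite mem_enum.
  by rewrite permKV.
by rewrite size_map -cardE card_Sn size_permutations ?iota_uniq ?size_iota.
Qed.

Lemma sum_words n (f : seq nat -> nat) :
  \sum_(s : 'S_n) f (word s) = \sum_(w <- permutations (iota 0 n)) f w.
Proof.
by rewrite -(perm_big _ (perm_eq_words n)) big_map big_enum.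
Qed.

Definition descent (w : seq nat) i := nth 0 w i.+1 < nth 0 w i.

(** The inner sum of maj has at most one term, at j = i + 1; the last position
contributes none. *)
Lemma maj_word n (s : 'S_n) :
  maj s = \sum_(i < n.-1 | descent (word s) i) i.+1.
Proof.
rewrite /maj; case: n s => [|n] s; first by rewrite !big_ord0.
rewrite big_ord_recr /= [X in _ + X]big1 ?addn0 => [|j]; last first.
  by move=> /andP[/eqP eq_j]; have := ltn_ord j; rewrite eq_j ltnn.
rewrite [RHS]big_mkcond; apply: eq_bigr => i _.
pose i0 : 'I_n.+1 := widen_ord (leqnSn n) i; pose i1 := lift ord0 i.
rewrite /descent (_ : i.+1 = i1 :> nat) //.
rewrite (_ : nth 0 (word s) i = s i0); last by rewrite -nth_word.
rewrite nth_word; case: ifP => lt_s; last first.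
  by rewrite big_pred0 // => j; rewrite val_eqE; case: eqP => // ->.
by rewrite (big_pred1 i1) // => j; rewrite val_eqE /=; case: eqP => [->|].
Qed.

(** * Patterns of length three *)

Definition shape (a b c : nat) : bool * bool * bool := (a < b, b < c, a < c).

(** In the order of the one-line notations 123, 132, 213, 231, 312, 321. *)
Definition shapes : seq (bool * bool * bool) :=
  [:: (true, true, true); (true, false, true); (false, true, true);
      (true, false, false); (false, true, false); (false, false, false)].

Lemma shape_in_shapes a b c : a != b -> b != c -> a != c -> shape a b c \in shapes.
Proof.
by rewrite /shape; case: (ltngtP a b) => // ? _; case: (ltngtP b c) => // ? _;
  case: (ltngtP a c) => // ?; lia.
Qed.

Definition perm_shape n (s : 'S_n) (i j k : 'I_n) := shape (s i) (s j) (s k).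

Lemma perm_shape_in_shapes n (s : 'S_n) (i j k : 'I_n) :
  i < j -> j < k -> perm_shape s i j k \in shapes.
Proof.
by move=> ltij ltjk; apply: shape_in_shapes; rewrite val_eqE (inj_eq perm_inj);
  apply/eqP=> eq_ij; move: ltij ltjk; rewrite ?eq_ij; lia.
Qed.

Lemma perm_gt n (s : 'S_n) (i j : 'I_n) : i != j -> (s i < s j) = ~~ (s j < s i).
Proof.
move=> neq_ij; rewrite -leqNgt [RHS]leq_eqVlt val_eqE (inj_eq perm_inj).
by rewrite (negPf neq_ij).
Qed.

Definition pattern_shape (p : 'S_3) := perm_shape p e1 e2 e3.

Lemma ord3_cases (i : 'I_3) : [\/ i = e1, i = e2 | i = e3].
Proof.
by case: i => [[|[|[|]]]] // lt_i; [constructor 1 | constructor 2 | constructor 3];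
  apply: val_inj.
Qed.

Lemma same_shape n (s : 'S_n) (p : 'S_3) (f : 'I_3 -> 'I_n) :
    injective f -> perm_shape s (f e1) (f e2) (f e3) = pattern_shape p ->
  forall x y, (s (f x) < s (f y)) = (p x < p y).
Proof.
move=> f_inj [eq12 eq23 eq13] x y.
by have [] := ord3_cases x => ->; have [] := ord3_cases y => ->;
  rewrite ?ltnn ?eq12 ?eq23 ?eq13 //;
  rewrite [in LHS]perm_gt ?(inj_eq f_inj) // [in RHS]perm_gt // ?eq12 ?eq23 ?eq13.
Qed.

(** A pattern is an occurrence of itself, so its shape fixes its order. *)
Lemma pattern_shape_inj : injective pattern_shape.
Proof.
by move=> p q eq_pq; apply: perm_order_inj => x y; apply: (@same_shape 3 p q id).
Qed.

Lemma containsP n (p : 'S_3) (s : 'S_n) :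
  reflect (exists i j k : 'I_n,
             [/\ i < j, j < k & perm_shape s i j k = pattern_shape p])
          (contains p s).
Proof.
apply: (iffP existsP) => [[f /andP[/forallP f_inc /forallP f_iso]] | ].
  exists (f e1), (f e2), (f e3); split.
  - by have /forallP/(_ e2)/implyP := f_inc e1; apply.
  - by have /forallP/(_ e3)/implyP := f_inc e2; apply.
  have s_iso x y : (s (f x) < s (f y)) = (p x < p y).
    by have /forallP/(_ y)/eqP := f_iso x.
  by rewrite /pattern_shape /perm_shape /shape !s_iso.
move=> [i [j [k [ltij ltjk eq_sp]]]].
pose f := [ffun x => tnth [tuple i; j; k] x].
have [f1 f2 f3] : [/\ f e1 = i, f e2 = j & f e3 = k] by rewrite !ffunE.
have f_inc (x y : 'I_3) : x < y -> f x < f y.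
  by have [] := ord3_cases x => ->; have [] := ord3_cases y => -> //;
    rewrite ?f1 ?f2 ?f3; lia.
have f_inj : injective f.
  move=> x y eq_f; apply: val_inj; case: (ltngtP x y) => // /f_inc;
  by rewrite eq_f ltnn.
exists f; apply/andP; split.
  by apply/forallP=> x; apply/forallP=> y; apply/implyP; apply: f_inc.
by apply/forallP=> x; apply/forallP=> y; apply/eqP; apply: same_shape;
  rewrite // f1 f2 f3.
Qed.

Definition shapes_of (Pi : {set 'S_3}) := [seq pattern_shape p | p in Pi].

Lemma AvP n (Pi : {set 'S_3}) (s : 'S_n) :
  reflect (forall i j k : 'I_n,
             i < j -> j < k -> perm_shape s i j k \notin shapes_of Pi)
          (s \in Av n Pi).
Proof.
rewrite inE; apply: (iffP forall_inP) => [avs i j k ltij ltjk | avs p pPi].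
  apply/imageP=> -[p pPi eq_sp]; have /containsP[] := avs p pPi.
  by exists i, j, k.
apply/containsP=> -[i [j [k [ltij ltjk eq_sp]]]].
by have /imageP[] := avs i j k ltij ltjk; exists p.
Qed.

(** * Associative idempotent operations and descent sets *)

Section Composition.

Variable op : bool -> bool -> bool.
Hypotheses (opA : associative op) (opbb : forall b, op b b = b).

(** The class of permutations in which the comparison of the outer entries of
every triple is computed by op from the other two; for the four operations of
interest it is the avoidance class of a pair of patterns. *)
Definition composes n (s : 'S_n) : bool :=
  [forall i : 'I_n, forall j : 'I_n, forall k : 'I_n,
     (i < j < k) ==> ((s i < s k) == op (s i < s j) (s j < s k))].

Lemma composesP n (s : 'S_n) :
  reflect (forall i j k : 'I_n,
             i < j -> j < k -> (s i < s k) = op (s i < s j) (s j < s k))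
          (composes s).
Proof.
apply: (iffP forallP) => [cs i j k ltij ltjk | cs i].
  have /forallP/(_ j)/forallP/(_ k)/implyP := cs i.
  by rewrite ltij ltjk => /(_ isT)/eqP.
apply/forallP=> j; apply/forallP=> k; apply/implyP=> /andP[ltij ltjk].
by apply/eqP; apply: cs.
Qed.

(** The op-product of asc i, ..., asc (i + d): since op has no unit, the product
runs over d + 1 factors. *)
Fixpoint fold_ascents (asc : pred nat) i d :=
  if d is d'.+1 then op (fold_ascents asc i d') (asc (i + d)) else asc i.

Definition less_between asc i j := fold_ascents asc i (j - i).-1.

Lemma less_betweenS asc i : less_between asc i i.+1 = asc i.
Proof. by rewrite /less_between subSnn. Qed.

Lemma fold_ascentsD asc i d e :
  fold_ascents asc i (d + e).+1
    = op (fold_ascents asc i d) (fold_ascents asc (i + d).+1 e).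
Proof.
elim: e => [|e IHe]; first by rewrite addn0 /= addnS.
rewrite addnS [LHS]/= -/(fold_ascents asc i (d + e).+1) IHe -opA /=.
by rewrite !addnS !addSn addnA.
Qed.

(** Associativity: the product over [i, k) splits at any j in between.  This is
the composition law that the comparisons of an avoiding permutation obey. *)
Lemma less_between_cat asc i j k : i < j -> j < k ->
  less_between asc i k = op (less_between asc i j) (less_between asc j k).
Proof.
move=> ltij ltjk; rewrite /less_between.
have -> : (k - i).-1 = ((j - i).-1 + (k - j).-1).+1 by lia.
by rewrite fold_ascentsD; congr (op _ (fold_ascents _ _ _)); lia.
Qed.

Lemma eq_less_between asc asc' i j : i < j ->
    (forall m, m < j -> asc m = asc' m) ->
  less_between asc i j = less_between asc' i j.
Proof.
move=> ltij eq_asc; rewrite /less_between.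
have : i + (j - i).-1 < j by lia.
elim: (j - i).-1 => [|d IHd] lt_d /=; first by rewrite eq_asc; lia.
by rewrite IHd 1?eq_asc //; lia.
Qed.

(** Iterating the composition law down to adjacent positions, where the
comparison is the ascent bit. *)
Lemma composes_less n (s : 'S_n) (i j : 'I_n) : composes s -> i < j ->
  (s i < s j) = less_between (fun m => ~~ descent (word s) m) i j.
Proof.
move=> /composesP cs; move: {2}(j - i) (leqnn (j - i)) => d.
elim: d j => [|d IHd] j le_d ltij; first by lia.
have lt_j' : j.-1 < n by have := ltn_ord j; lia.
pose j' := Ordinal lt_j'; have def_j : j = j'.+1 :> nat by rewrite /=; lia.
have step : (s j' < s j) = ~~ descent (word s) j'.
  rewrite /descent -def_j !nth_word perm_gt //.
  by rewrite -val_eqE /=; lia.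
have [eq_i | neq_i] := eqVneq i j'.
  by rewrite def_j eq_i less_betweenS step.
have ltij' : i < j' by move: neq_i; rewrite -val_eqE /=; lia.
rewrite (cs i j' j) ?def_j // IHd //=; last by lia.
rewrite -/(nat_of_ord j') -def_j step (less_between_cat _ ltij' (_ : j' < j)) ?def_j //.
by rewrite less_betweenS.
Qed.

Definition descent_set n (s : 'S_n) : {set 'I_n.-1} :=
  [set i : 'I_n.-1 | descent (word s) i].

Lemma descent_set_inj n : {in [pred s | composes s] &, injective (@descent_set n)}.
Proof.
move=> s t cs ct /setP eq_des; rewrite !inE in cs ct.
have eq_st (i j : 'I_n) : i < j -> (s i < s j) = (t i < t j).
  move=> ltij; rewrite !composes_less //; apply: eq_less_between => // m ltmj.
  have lt_m : m < n.-1 by have := ltn_ord j; lia.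
  by have := eq_des (Ordinal lt_m); rewrite !inE /= => ->.
apply: perm_order_inj => i j; case: (ltngtP i j) => [||/val_inj->]; first exact: eq_st.
  move=> ltji; have neq_ij : i != j by rewrite -val_eqE /=; lia.
  by rewrite perm_gt // eq_st // -perm_gt.
by rewrite !ltnn.
Qed.

(** The candidate order compares i < j by the product of the prescribed ascent
bits.  The only obstruction to transitivity is a cyclic triple i < j < k, with
F i j = F j k = b but F i k = ~~ b; it is excluded by F i k = op b b = b. *)
Lemma descent_set_surj n (A : {set 'I_n.-1}) :
  exists2 s : 'S_n, composes s & descent_set s = A.
Proof.
pose asc m := m \notin [seq val i | i in A].
pose F := less_between asc.
have F_cat i j k : i < j -> j < k -> F i k = op (F i j) (F j k).
  exact: less_between_cat.
pose R (i j : 'I_n) := if i < j then F i j else (j < i) && ~~ F j i.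
have [] := @perm_of_order n R.
- by move=> i; rewrite /R !ltnn.
- move=> y x z; rewrite /R.
  case: (ltngtP x y) => // [ltxy | ltyx] //;
  case: (ltngtP y z) => // [ltyz | ltzy] //;
  case: (ltngtP x z) => // [ltxz | ltzx | eqxz] //; try by (exfalso; lia).
  (* For distinct x, y, z, expand the comparison of the two extreme ones. *)
  + by rewrite (F_cat x y z) //; case: (F x y); case: (F y z); rewrite ?opbb.
  + by rewrite (F_cat x z y) //; case: (F x z); case: (F z y); rewrite ?opbb.
  + by rewrite (F_cat z x y) //; case: (F z x); case: (F x y); rewrite ?opbb.
  + by rewrite eqxz; case: (F z y).
  + by rewrite (F_cat y x z) //; case: (F y x); case: (F x z); rewrite ?opbb.
  + by rewrite (F_cat y z x) //; case: (F y z); case: (F z x); rewrite ?opbb.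
  + by rewrite eqxz; case: (F y z).
  + by rewrite (F_cat z y x) //; case: (F z y); case: (F y x); rewrite ?opbb.
- by move=> i j; rewrite /R -val_eqE /=; case: ltngtP => // _ _; case: (F _ _).
move=> s sR; exists s.
  apply/composesP=> i j k ltij ltjk; rewrite !sR /R ltij ltjk (ltn_trans ltij ltjk).
  exact: F_cat.
apply/setP=> i; rewrite inE /descent.
have lt_i1 : i.+1 < n by have := ltn_ord i; lia.
have := nth_word s (Ordinal (ltnW lt_i1)); have := nth_word s (Ordinal lt_i1).
move=> /= -> ->; rewrite sR /R /= [i.+1 < i]ltnNge leqnSn /=.
rewrite ltnS leqnn /F less_betweenS negbK mem_map ?mem_enum //.
exact: val_inj.
Qed.

Lemma sum_composing n :
  (\sum_(s : 'S_n | composes s) 'X^(maj s)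
     = \sum_(A : {set 'I_n.-1}) 'X^(\sum_(i in A) i.+1) :> {poly int})%R.
Proof.
have -> : (\sum_(A : {set 'I_n.-1}) 'X^(\sum_(i in A) i.+1)
            = \sum_(A in @descent_set n @: [set s | composes s])
                 'X^(\sum_(i in A) i.+1) :> {poly int})%R.
  apply: eq_bigl => A; apply/esym/imsetP.
  by have [s cs <-] := descent_set_surj A; exists s; rewrite ?inE.
rewrite big_imset /= => [|s t]; last by rewrite !inE; apply: descent_set_inj.
apply: eq_big => s; first by rewrite inE.
by rewrite maj_word => _; congr ('X^_)%R; apply: eq_bigl => i; rewrite inE.
Qed.

(** The hypothesis says that the forbidden triples (a, b, c) are those with
c <> op a b; the right-hand side depends neither on op nor on Pi. *)
Lemma M_descent_sets n (Pi : {set 'S_3}) :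
    {in shapes, forall t, (t \in shapes_of Pi) = (t.2 != op t.1.1 t.1.2)} ->
  (M n Pi = \sum_(A : {set 'I_n.-1}) 'X^(\sum_(i in A) i.+1))%R.
Proof.
move=> defPi; rewrite /M -sum_composing; apply: eq_bigl => s.
apply/AvP/composesP=> cs i j k ltij ltjk.
  have := cs i j k ltij ltjk.
  by rewrite defPi ?perm_shape_in_shapes // negbK => /eqP.
by rewrite defPi ?perm_shape_in_shapes // negbK; apply/eqP/cs.
Qed.

End Composition.

Lemma pattern_shapeE (t : 3.-tuple 'I_3) (t_uniq : uniq t) :
  pattern_shape (oneline t_uniq) = shape (tnth t e1) (tnth t e2) (tnth t e3).
Proof. by rewrite /pattern_shape /perm_shape !onelineE. Qed.

Definition patterns : seq 'S_3 := [:: p123; p132; p213; p231; p312; p321].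

Lemma map_pattern_shape : map pattern_shape patterns = shapes.
Proof. by rewrite /= !pattern_shapeE. Qed.

(** The six listed patterns realise all the shapes that a triple can have. *)
Lemma mem_patterns p : p \in patterns.
Proof.
rewrite -(mem_map pattern_shape_inj) map_pattern_shape.
exact: perm_shape_in_shapes.
Qed.

Lemma shapes_of_pair p q :
  shapes_of [set p; q] =i [:: pattern_shape p; pattern_shape q].
Proof.
move=> t; apply/imageP/idP => [[r + ->] | ]; rewrite !inE.
  by case/orP=> /eqP->; rewrite eqxx ?orbT.
by case/orP=> /eqP->; [exists p | exists q]; rewrite ?inE ?eqxx ?orbT.
Qed.

Definition composing_pairs : seq {set 'S_3} :=
  [:: [set p132; p213]; [set p132; p312]; [set p213; p231]; [set p231; p312]].

Lemma M_composing_pairs n Pi : Pi \in composing_pairs ->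
  (M n Pi = \sum_(A : {set 'I_n.-1}) 'X^(\sum_(i in A) i.+1))%R.
Proof.
rewrite !inE => /or4P[] /eqP->.
- apply: (@M_descent_sets andb) => [||t]; [exact: andbA | exact: andbb |].
  by rewrite shapes_of_pair !pattern_shapeE; case: t => [[[] []] []].
- apply: (@M_descent_sets (fun _ b => b)) => // t.
  by rewrite shapes_of_pair !pattern_shapeE; case: t => [[[] []] []].
- apply: (@M_descent_sets (fun a _ => a)) => // t.
  by rewrite shapes_of_pair !pattern_shapeE; case: t => [[[] []] []].
apply: (@M_descent_sets orb) => [||t]; [exact: orbA | exact: orbb |].
by rewrite shapes_of_pair !pattern_shapeE; case: t => [[[] []] []].
Qed.

(** * Separating the other pairs in lengths three and four *)

(** A subset of S_3 is encoded as a mask on the list of patterns, so that the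
separation of subsets becomes a computation on bit sequences. *)
Definition code (Pi : {set 'S_3}) : bitseq := [seq p \in Pi | p <- patterns].

Lemma code_inj : injective code.
Proof.
move=> Pi Pi' /eq_in_map eq_code; apply/setP=> p.
exact: eq_code (mem_patterns p).
Qed.

Lemma shapes_of_code Pi : shapes_of Pi =i mask (code Pi) shapes.
Proof.
move=> t; rewrite -map_pattern_shape -map_mask -filter_mask.
apply/imageP/mapP=> -[p pPi ->]; exists p => //.
  by rewrite mem_filter mem_patterns andbT.
by move: pPi; rewrite mem_filter => /andP[].
Qed.

Lemma count_code Pi : count id (code Pi) = #|Pi|.
Proof.
rewrite count_map cardE -size_filter; apply/perm_size/uniq_perm.
- by rewrite filter_uniq // -(map_inj_uniq pattern_shape_inj) map_pattern_shape.
- exact: enum_uniq.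
by move=> p; rewrite mem_filter mem_patterns mem_enum andbT.
Qed.

Fixpoint bitseqs n : seq bitseq :=
  if n is n'.+1 then
    [seq true :: m | m <- bitseqs n'] ++ [seq false :: m | m <- bitseqs n']
  else [:: [::]].

Lemma mem_bitseqs n m : size m = n -> m \in bitseqs n.
Proof.
elim: n m => [|n IHn] [|b m] //= [/IHn m_in]; rewrite mem_cat.
by case: b; rewrite map_f ?orbT.
Qed.

(** The major index and the avoidance test are restated on words, where they
compute by reduction. *)
Definition word_maj (w : seq nat) : nat :=
  sumn [seq i.+1 | i <- iota 0 (size w).-1 & descent w i].

Definition word_avoids (T : seq (bool * bool * bool)) (w : seq nat) : bool :=
  let r := iota 0 (size w) in
  all (fun i => all (fun j => all (fun k => (i < j < k) ==>
    (shape (nth 0 w i) (nth 0 w j) (nth 0 w k) \notin T)) r) r) r.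

Lemma word_majE n (s : 'S_n) : word_maj (word s) = maj s.
Proof.
rewrite maj_word /word_maj sumnE size_word big_map big_filter.
by rewrite -[in LHS](subn0 n.-1) -/(index_iota _ _) big_mkord.
Qed.

Lemma word_avoidsE n (Pi : {set 'S_3}) (s : 'S_n) :
  word_avoids (mask (code Pi) shapes) (word s) = (s \in Av n Pi).
Proof.
rewrite /word_avoids size_word; apply/idP/AvP => [avs i j k ltij ltjk | avs].
  have in_r (x : 'I_n) : val x \in iota 0 n by rewrite mem_iota /=.
  have /allP/(_ _ (in_r j))/allP/(_ _ (in_r k)) := allP avs _ (in_r i).
  by rewrite ltij ltjk shapes_of_code !nth_word.
apply/allP=> i; rewrite mem_iota => /= lti; apply/allP=> j; rewrite mem_iota => /= ltj.
apply/allP=> k; rewrite mem_iota => /= ltk; apply/implyP=> /andP[ltij ltjk].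
have := avs (Ordinal lti) (Ordinal ltj) (Ordinal ltk) ltij ltjk.
by rewrite shapes_of_code /perm_shape -!nth_word.
Qed.

Definition maj_count n (m : bitseq) k : nat :=
  count (word_avoids (mask m shapes))
        [seq w <- permutations (iota 0 n) | word_maj w == k].

Lemma coef_M n (Pi : {set 'S_3}) k : ((M n Pi)`_k = (maj_count n (code Pi) k)%:R)%R.
Proof.
rewrite /maj_count count_filter -sum1_count big_mkcond -sum_words.
rewrite /M coef_sum natr_sum big_mkcond; apply: eq_bigr => s _.
rewrite /= word_avoidsE word_majE coefXn eq_sym.
by case: (s \in Av n Pi) => //=; case: eqP.
Qed.

(** Length three cannot tell 132 from 231, nor 213 from 312; the coefficients of
q^2 and q^4 in length four resolve this for all pairs but the four above. *)
Definition signature (m : bitseq) : seq nat :=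
  [seq maj_count 3 m k | k <- [:: 0; 1; 2; 3]] ++
  [seq maj_count 4 m k | k <- [:: 2; 4]].

Lemma maj_Wilf_signature Pi Pi' :
  maj_Wilf Pi Pi' -> signature (code Pi) = signature (code Pi').
Proof.
move=> eqM; rewrite /signature; congr (_ ++ _); apply: eq_map => k;
  apply/eqP; by rewrite -(Num.Theory.eqr_nat int) -!coef_M eqM.
Qed.

Definition composing_codes : seq bitseq :=
  [:: [:: false; true; true; false; false; false];
      [:: false; true; false; false; true; false];
      [:: false; false; true; true; false; false];
      [:: false; false; false; true; true; false]].

Lemma map_code_composing_pairs : map code composing_pairs = composing_codes.
Proof.
by rewrite /= /code /= !inE -!(inj_eq pattern_shape_inj) !pattern_shapeE.
Qed.

(** The signatures are tabulated so that each is evaluated only once. *)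
Definition signature_table : seq (bitseq * seq nat) :=
  [seq (m, signature m) | m <- bitseqs 6].

Lemma signature_separates :
  (fun table => all (fun x => (count id x.1 == 2) ==>
     all (fun y => (x.2 == y.2) ==>
       (x.1 == y.1) || (x.1 \in composing_codes) && (y.1 \in composing_codes))
     table) table) signature_table.
Proof. by vm_compute. Qed.

(** Only the first set is assumed to be a pair: equality of the values at q = 1
in length three forces the second one to have the same size. *)
Lemma maj_Wilf_pair (Pi Pi' : {set 'S_3}) : #|Pi| = 2 -> maj_Wilf Pi Pi' ->
  Pi = Pi' \/ Pi \in composing_pairs /\ Pi' \in composing_pairs.
Proof.
move=> cardPi /maj_Wilf_signature eq_sig.
have in_table Q : (code Q, signature (code Q)) \in signature_table.
  by apply: (map_f (fun m => (m, signature m))); apply: mem_bitseqs.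
have /implyP := allP signature_separates _ (in_table Pi).
rewrite [count _ _]count_code cardPi => /(_ isT) /allP/(_ _ (in_table Pi')).
rewrite [_.2]/= [in X in X == _]eq_sig eqxx implyTb [_.1]/=.
rewrite -map_code_composing_pairs !(mem_map code_inj).
by case/orP=> [/eqP/code_inj | /andP]; [left | right].
Qed.

Theorem theorem5p1 :
  (forall Pi : {set 'S_3},
     maj_Wilf_class [set p132; p213] Pi <->
     Pi \in [set [set p132; p213]; [set p132; p312];
                 [set p213; p231]; [set p231; p312]]) /\
  (forall Pi : {set 'S_3},
     #|Pi| = 2 -> Pi <> [set p123; p321] ->
     ~ maj_Wilf_class [set p132; p213] Pi ->
     forall Pi' : {set 'S_3}, maj_Wilf_class Pi Pi' <-> Pi' = Pi).
Proof.
have in_set Pi : (Pi \in [set [set p132; p213]; [set p132; p312];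
    [set p213; p231]; [set p231; p312]]) = (Pi \in composing_pairs).
  by rewrite !inE !orbA.
have head_in : [set p132; p213] \in composing_pairs by rewrite inE eqxx.
have classE Pi : maj_Wilf_class [set p132; p213] Pi <-> Pi \in composing_pairs.
  split=> [/maj_Wilf_pair[] | Pi_in n]; last by rewrite !M_composing_pairs.
  - by rewrite cards2 -(inj_eq pattern_shape_inj) !pattern_shapeE.
  - by move=> <-.
  - by case.
split=> [Pi | Pi cardPi _ notPi Pi']; first by rewrite in_set; exact: classE.
split=> [/(maj_Wilf_pair cardPi)[-> // | [Pi_in _]] | -> n //].
by case: notPi; apply/classE.
Qed.
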